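(* Let $K$ be an arbitrary field, $R$ a $K$-algebra, and $J$ an ideal of $R$. If $J$ and $R/J$ are both locally matricial $K$-algebras, then $R$ is a locally matricial $K$-algebra.
   Context: All algebras are associative but not necessarily unital $K$-algebras; ideals are two-sided ring ideals that are also $K$-subspaces. A $K$-algebra is matricial if it is isomorphic to $\prod_{i=1}^k M_{n_i}(K)$ for some positive integers $n_1,\dots,n_k$. A $K$-algebra $R$ is locally matricial if every finite subset of $R$ is contained in a matricial subalgebra of $R$. *)

(* Defs.v *)
(* MathComp has no structure for NON-unital associative
   algebras, so a (possibly non-unital) K-algebra is given here by an explicit
   carrier type with its operations (nalg_ops) and the axioms (is_nalg). *)
From HB Require Import structures.
From mathcomp Require Import all_boot all_algebra.
From Stdlib Require Import ClassicalEpsilon.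

Set Implicit Arguments.
Unset Strict Implicit.
Unset Printing Implicit Defensive.

Import GRing.Theory.
Local Open Scope ring_scope.

Record nalg_ops (K : fieldType) (A : Type) := NAlgOps {
  nzero : A;
  nadd : A -> A -> A;
  nopp : A -> A;
  nscale : K -> A -> A;
  nmul : A -> A -> A }.

Arguments nzero {K A} _.
Arguments nadd {K A} _.
Arguments nopp {K A} _.
Arguments nscale {K A} _.
Arguments nmul {K A} _.

Definition is_nalg (K : fieldType) (A : Type) (o : nalg_ops K A) : Prop :=
  (forall x y z, nadd o x (nadd o y z) = nadd o (nadd o x y) z) /\
  (forall x y, nadd o x y = nadd o y x) /\
  (forall x, nadd o (nzero o) x = x) /\
  (forall x, nadd o (nopp o x) x = nzero o) /\
  (forall (a : K) x y, nscale o a (nadd o x y) = nadd o (nscale o a x) (nscale o a y)) /\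
  (forall (a b : K) x, nscale o (a + b) x = nadd o (nscale o a x) (nscale o b x)) /\
  (forall (a b : K) x, nscale o a (nscale o b x) = nscale o (a * b) x) /\
  (forall x, nscale o 1 x = x) /\
  (forall x y z, nmul o x (nmul o y z) = nmul o (nmul o x y) z) /\
  (forall x y z, nmul o x (nadd o y z) = nadd o (nmul o x y) (nmul o x z)) /\
  (forall x y z, nmul o (nadd o x y) z = nadd o (nmul o x z) (nmul o y z)) /\
  (forall (a : K) x y, nscale o a (nmul o x y) = nmul o (nscale o a x) y) /\
  (forall (a : K) x y, nscale o a (nmul o x y) = nmul o x (nscale o a y)).

(* The matricial algebra prod_{i<k} M_{n_i}(K), n_i = (n i).+1 >= 1,
   with componentwise operations. *)
Definition matprod (K : fieldType) (k : nat) (n : 'I_k -> nat) : Type :=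
  forall i : 'I_k, 'M[K]_((n i).+1).

Definition is_alg_hom (K : fieldType) (A : Type) (o : nalg_ops K A)
    (k : nat) (n : 'I_k -> nat) (phi : matprod K n -> A) : Prop :=
  (forall x y : matprod K n, phi (fun i => x i + y i) = nadd o (phi x) (phi y)) /\
  (forall (a : K) (x : matprod K n), phi (fun i => a *: x i) = nscale o a (phi x)) /\
  (forall x y : matprod K n, phi (fun i => x i *m y i) = nmul o (phi x) (phi y)).

Definition is_subalg (K : fieldType) (A : Type) (o : nalg_ops K A) (S : A -> Prop) : Prop :=
  S (nzero o) /\
  (forall x y, S x -> S y -> S (nadd o x y)) /\
  (forall x, S x -> S (nopp o x)) /\
  (forall (a : K) x, S x -> S (nscale o a x)) /\
  (forall x y, S x -> S y -> S (nmul o x y)).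

Definition matricial_subalg (K : fieldType) (A : Type) (o : nalg_ops K A)
    (S : A -> Prop) : Prop :=
  is_subalg o S /\
  exists (k : nat) (n : 'I_k -> nat) (phi : matprod K n -> A),
    is_alg_hom o phi /\ injective phi /\ (forall x, S x <-> exists y, phi y = x).

Definition locally_matricial (K : fieldType) (A : Type) (o : nalg_ops K A) : Prop :=
  forall s : seq A, exists S : A -> Prop,
    matricial_subalg o S /\ (forall x, List.In x s -> S x).

Record nideal (K : fieldType) (A : Type) (o : nalg_ops K A) := NIdeal {
  nidl :> A -> Prop;
  nidl0 : nidl (nzero o);
  nidlD : forall x y, nidl x -> nidl y -> nidl (nadd o x y);
  nidlN : forall x, nidl x -> nidl (nopp o x);
  nidlZ : forall (a : K) x, nidl x -> nidl (nscale o a x);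
  nidlMl : forall r x, nidl x -> nidl (nmul o r x);
  nidlMr : forall r x, nidl x -> nidl (nmul o x r) }.

Section IdealAlgebras.
Variables (K : fieldType) (A : Type) (o : nalg_ops K A) (J : nideal o).

Definition ideal_sort : Type := {x : A | J x}.

Definition ideal_ops : nalg_ops K ideal_sort :=
  NAlgOps
    (exist _ (nzero o) (nidl0 J))
    (fun x y => exist _ (nadd o (proj1_sig x) (proj1_sig y))
                  (nidlD (proj2_sig x) (proj2_sig y)))
    (fun x => exist _ (nopp o (proj1_sig x)) (nidlN (proj2_sig x)))
    (fun a x => exist _ (nscale o a (proj1_sig x)) (nidlZ a (proj2_sig x)))
    (fun x y => exist _ (nmul o (proj1_sig x) (proj1_sig y))
                  (nidlMl (proj1_sig x) (proj2_sig y))).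

Definition coset (x : A) : A -> Prop := fun y => J (nadd o x (nopp o y)).

Definition quot_sort : Type := {C : A -> Prop | exists x, C = coset x}.

Definition qclass (x : A) : quot_sort := exist _ (coset x) (ex_intro _ x erefl).

Definition qrep (C : quot_sort) : A :=
  proj1_sig (constructive_indefinite_description _ (proj2_sig C)).

Definition quot_ops : nalg_ops K quot_sort :=
  NAlgOps
    (qclass (nzero o))
    (fun C D => qclass (nadd o (qrep C) (qrep D)))
    (fun C => qclass (nopp o (qrep C)))
    (fun a C => qclass (nscale o a (qrep C)))
    (fun C D => qclass (nmul o (qrep C) (qrep D))).

End IdealAlgebras.

(* Main.v *)
(** Work in the unitization of R. The ideal J is von Neumann regular, so a
    finitely generated right ideal of J has the form e J with e idempotent.

    Lifting: let b be lifts to R of the matrix units of a matricial subalgebra of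
    R/J. Their defects lie in J; let u be an idempotent of J that is a left unit
    for the defects, and choose e with e J = u J + sum b u J. Then e J is stable
    under left multiplication by b, and (1 - e) b (1 - e) are honest matrix units.

    Absorbing: let f be matrix units of R and X a finite subset of J. Averaging
    over f produces an idempotent e of J that commutes with f and is a two-sided
    unit for X. A corner e S e of a matricial subalgebra S of J contains X and
    e f, it is matricial, and it is orthogonal to the matrix units (1 - e) f.
    Their direct sum is the matricial subalgebra sought. *)
Require Import Defs.
From HB Require Import structures.
From mathcomp Require Import all_boot all_algebra.
From mathcomp Require Import boolp.
From Stdlib Require Import FunctionalExtensionality.

Set Implicit Arguments.
Unset Strict Implicit.
Unset Printing Implicit Defensive.

Import GRing.Theory.
Local Open Scope ring_scope.

(** * Idempotents and matrix units in a ring with a regular ideal *)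

Record two_sided_ideal (A : nzRingType) (J : A -> Prop) : Prop := TwoSidedIdeal {
  tsideal0 : J 0;
  tsidealB : forall x y, J x -> J y -> J (x - y);
  tsidealMl : forall a x, J x -> J (a * x);
  tsidealMr : forall a x, J x -> J (x * a) }.

Definition regular_ideal (A : nzRingType) (J : A -> Prop) : Prop :=
  forall x, J x -> exists2 y, J y & x * y * x = x.

(* [c p] is the block of the index p; entries between different blocks vanish. *)
Record mx_units (A : nzRingType) (I L : finType) (c : I -> L)
    (E : I -> I -> A) : Prop := MxUnits {
  mx_units0 : forall p q, c p != c q -> E p q = 0;
  mx_unitsM : forall p q r s, c p = c q -> c r = c s ->
    E p q * E r s = E p s *+ (q == r) }.

Section RingIdeals.
Variables (A : nzRingType) (J : A -> Prop).
Hypothesis idJ : two_sided_ideal J.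

Lemma tsidealN x : J x -> J (- x).
Proof. by move=> Jx; rewrite -sub0r; apply: (tsidealB idJ) => //; apply: (tsideal0 idJ). Qed.

Lemma tsidealD x y : J x -> J y -> J (x + y).
Proof. by move=> Jx Jy; rewrite -[y]opprK; apply: (tsidealB idJ) => //; apply: tsidealN. Qed.

Lemma tsideal_sum (T : Type) (s : seq T) (F : T -> A) :
  (forall i, J (F i)) -> J (\sum_(i <- s) F i).
Proof. by move=> JF; apply: big_ind => // [|x y]; [apply: (tsideal0 idJ)|apply: tsidealD]. Qed.

Hypothesis regJ : regular_ideal J.

(** Induction on the list: if [e] serves the tail, the remainder y' = y - e y has a quasi-inverse z,
    and g = y' z (1 - e) is an idempotent orthogonal to [e] with g y = y', so e + g serves the whole
    list. The last clause encodes, as an induction principle, that [e] lies in the right ideal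
    generated by [s]. *)
Lemma fg_right_ideal_idem (s : seq A) : {in s, forall x, J x} ->
  exists e, [/\ J e, e * e = e, {in s, forall x, e * x = x} &
    forall P : A -> Prop, P 0 -> (forall x y, P x -> P y -> P (x - y)) ->
      (forall x a, P x -> P (x * a)) -> {in s, forall x, P x} -> P e].
Proof.
elim: s => [|y s IHs] Js.
  by exists 0; split=> //; [apply: (tsideal0 idJ) | rewrite mulr0].
have [x xs|e [Je ee es minE]] := IHs; first by apply: Js; rewrite inE xs orbT.
have Jy : J y by apply: Js; rewrite inE eqxx.
have [y' y'E] : exists y', y' = y - e * y by exists (y - e * y).
have Jy' : J y' by rewrite y'E; apply: (tsidealB idJ) => //; apply: (tsidealMl idJ).
have [z Jz yzy] := regJ Jy'.
have ey' : e * y' = 0 by rewrite y'E mulrBr mulrA ee subrr.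
pose g := y' * z * (1 - e).
have eg : e * g = 0 by rewrite /g !mulrA ey' !mul0r.
have ge : g * e = 0 by rewrite /g -!mulrA mulrBl ee mul1r subrr !mulr0.
have gy' : g * y' = y' by rewrite /g -mulrA mulrBl ey' mul1r subr0.
have gg : g * g = g by rewrite {2}/g !mulrA gy'.
have gy : g * y = y'.
  by rewrite -{1}[y](subrK (e * y)) -y'E mulrDr mulrA ge mul0r gy' addr0.
exists (e + g); split.
- by apply: tsidealD => //; rewrite /g; apply: (tsidealMr idJ); apply: (tsidealMl idJ).
- by rewrite mulrDl !mulrDr ee eg ge gg addr0 add0r.
- move=> x; rewrite inE => /predU1P[->|xs]; first by rewrite mulrDl gy y'E addrC subrK.
  by rewrite mulrDl -{2}(es x xs) mulrA ge mul0r addr0 es.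
- move=> P P0 PS PM Ps.
  have Pe : P e by apply: minE => // x xs; apply: (Ps); rewrite inE xs orbT.
  have PN x : P x -> P (- x) by move=> Px; rewrite -sub0r; apply: (PS).
  rewrite -[g]opprK; apply: (PS) => //; apply: (PN); apply: (PM); apply: (PM).
  by rewrite y'E; apply: (PS); [apply: (Ps); rewrite inE eqxx | apply: (PM)].
Qed.

(** * Idempotents commuting with matrix units *)

Section CommutingUnit.
Variables (I L : finType) (c : I -> L) (f : I -> I -> A).
Hypothesis muf : mx_units c f.

Lemma mx_unitsMid p q r : c p = c q -> c q = c r -> f p q * f q r = f p r.
Proof. by move=> pq qr; rewrite (mx_unitsM muf) // eqxx. Qed.

Let F := \sum_p f p p.

Lemma mx_units_sumr r s : f r s * F = f r s.
Proof.
have [rs|rs] := eqVneq (c r) (c s); last by rewrite (mx_units0 muf rs) mul0r.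
rewrite mulr_sumr (bigD1 s) //= mx_unitsMid // big1 ?addr0 // => p ps.
by rewrite (mx_unitsM muf) // eq_sym (negPf ps).
Qed.

Lemma mx_units_suml r s : F * f r s = f r s.
Proof.
have [rs|rs] := eqVneq (c r) (c s); last by rewrite (mx_units0 muf rs) mulr0.
rewrite mulr_suml (bigD1 r) //= mx_unitsMid // big1 ?addr0 // => p ps.
by rewrite (mx_unitsM muf) // (negPf ps).
Qed.

(** A representative of the block of p that depends only on the block; the default is never reached,
    as p itself qualifies. *)
Let rho p := odflt p [pick r | c r == c p].

Let c_rho p : c (rho p) = c p.
Proof. by rewrite /rho; case: pickP => // r /eqP. Qed.

Let rho_eq p q : c p = c q -> rho p = rho q.
Proof.
move=> pq; rewrite /rho -pq; case: pickP => //= /(_ p).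
by rewrite eqxx.
Qed.

(* The right ideal e J of [fg_right_ideal_idem] is stable under the matrix
   units, so averaging e over them gives an idempotent with the same image. *)
Lemma commuting_left_unit (X : seq A) : {in X, forall x, J x} ->
  exists e, [/\ J e, e * e = e, forall p q, e * f p q = f p q * e &
    {in X, forall x, e * x = x}].
Proof.
(* The added products make the right ideal generated by [Y] stable under left multiplication by
   [f]. *)
move=> JX; pose Y := X ++ [seq f t.1 t.2 * x | t <- enum {: I * I}, x <- X].
have [y|e [Je ee eY minE]] := @fg_right_ideal_idem Y.
  rewrite mem_cat => /orP[/JX //|/allpairsP[[t x] /= [_ xX ->]]].
  by apply: (tsidealMl idJ); apply: JX.
have eX x : x \in X -> e * x = x by move=> xX; apply: eY; rewrite mem_cat xX.
have efX p q x : x \in X -> e * (f p q * x) = f p q * x.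
  move=> xX; apply: eY; rewrite mem_cat; apply/orP; right.
  by apply/allpairsP; exists ((p, q), x); rewrite /= mem_enum.
(* The z for which every f p q z is fixed by [e] form a right ideal containing [Y], hence containing
   [e]. *)
have efe p q : e * (f p q * e) = f p q * e.
  have: forall p q, e * (f p q * e) = f p q * e; last exact.
  apply: (minE (fun z => forall p q, e * (f p q * z) = f p q * z)) => //.
  - by move=> *; rewrite !mulr0.
  - by move=> x y Px Py r s; rewrite !mulrBr Px Py.
  - by move=> x a Px r s; rewrite !mulrA -(mulrA e) Px.
  move=> y; rewrite mem_cat => /orP[yX r s|/allpairsP[[[u v] x] /= [_ xX ->]] r s].
    exact: efX.
  rewrite (mulrA (f r s)).
  have [rs|/eqP/(mx_units0 muf) ->] := (c r =P c s); last by rewrite !mul0r mulr0.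
  have [uv|/eqP/(mx_units0 muf) ->] := (c u =P c v); last by rewrite !mulr0 mul0r mulr0.
  by rewrite (mx_unitsM muf) //; case: eqP => _; rewrite ?mulr1n ?mulr0n ?efX // mul0r mulr0.
pose g := 1 - F.
have fg r s : f r s * g = 0 by rewrite mulrBr mulr1 mx_units_sumr subrr.
have gf r s : g * f r s = 0 by rewrite mulrBl mul1r mx_units_suml subrr.
have gg : g * g = g.
  by rewrite {1}/g mulrBl mul1r mulr_suml big1 ?subr0 // => p _; rewrite fg.
have ege : e * (g * e) = g * e.
  rewrite mulrBl mul1r mulrBr ee; congr (_ - _).
  by rewrite mulr_suml mulr_sumr; apply: eq_bigr => p _; rewrite efe.
have Fg : F + g = 1 by rewrite addrC subrK.
clearbody g.
(* Conjugating from one fixed index [rho p] per block makes the sum commute with [f] without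
   dividing by block sizes, so any characteristic is allowed. The term g e g covers the complement
   of [F]. *)
pose e' := \sum_p f p (rho p) * e * f (rho p) p + g * e * g.
(* Together with e' e = e this says that both elements generate the same right ideal; idempotency
   and the action on [X] follow. *)
have ee' : e * e' = e'.
  rewrite mulrDr !mulrA -(mulrA e g) ege mulr_sumr; congr (_ + _).
  by apply: eq_bigr => p _; rewrite !mulrA -(mulrA e) efe.
have e'e : e' * e = e.
  transitivity (F * e + g * e); last by rewrite -mulrDl Fg mul1r.
  rewrite mulrDl -!mulrA ege (mulrA g) gg; congr (_ + _).
  rewrite !mulr_suml; apply: eq_bigr => p _.
  by rewrite -!mulrA efe mulrA mx_unitsMid.
exists e'; split.
- apply: tsidealD; last by apply: (tsidealMr idJ); apply: (tsidealMl idJ).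
  by apply: tsideal_sum => p; apply: (tsidealMr idJ); apply: (tsidealMl idJ).
- by rewrite -{2}ee' mulrA e'e ee'.
- move=> r s; have [rs|rs] := eqVneq (c r) (c s); last first.
    by rewrite (mx_units0 muf rs) mulr0 mul0r.
  rewrite mulrDl mulrDr -!mulrA gf !mulr0 addr0 !mulrA fg !mul0r addr0.
  rewrite mulr_suml mulr_sumr (bigD1 r) //= [RHS](bigD1 s) //=.
  rewrite [X in _ + X = _]big1 => [|p pr]; last first.
    by rewrite -!mulrA (mx_unitsM muf) ?c_rho // (negPf pr) !mulr0.
  rewrite [X in _ = _ + X]big1 => [|p ps]; last first.
    by rewrite !mulrA (mx_unitsM muf) ?c_rho // eq_sym (negPf ps) !mul0r.
  by rewrite -!mulrA mx_unitsMid ?c_rho // !mulrA mx_unitsMid ?c_rho // (rho_eq rs).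
- by move=> x xX; rewrite -{1}(eX x xX) mulrA e'e eX.
Qed.

End CommutingUnit.
End RingIdeals.

(** * Two-sided units and lifting of matrix units *)

Section TwoSided.
Variables (A : nzRingType) (J : A -> Prop).
Hypotheses (idJ : two_sided_ideal J) (regJ : regular_ideal J).
Variables (I L : finType) (c : I -> L).

(** The left version in the opposite ring, where transposing the indices of [f] restores the matrix
    unit relations. *)
Lemma commuting_right_unit (f : I -> I -> A) (X : seq A) :
  mx_units c f -> {in X, forall x, J x} ->
  exists e, [/\ J e, e * e = e, forall p q, e * f p q = f p q * e &
    {in X, forall x, x * e = x}].
Proof.
move=> muf JX.
have idJc : @two_sided_ideal A^c J.
  split; [exact: (tsideal0 idJ) | exact: (tsidealB idJ)
         | by move=> a; apply: (tsidealMr idJ) | by move=> a; apply: (tsidealMl idJ)].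
have regJc : @regular_ideal A^c J.
  by move=> x /regJ[y Jy xyx]; exists y => //; rewrite -{3}xyx -mulrA.
have mufc : @mx_units A^c I L c (fun p q => f q p).
  split=> [p q|p q r s pq rs]; first by rewrite eq_sym; apply: (mx_units0 muf).
  by rewrite [LHS](mx_unitsM muf) // eq_sym.
have [e [Je ee fe eX]] := commuting_left_unit idJc regJc mufc JX.
by exists e; split=> // p q; rewrite -[LHS]fe.
Qed.

Lemma commuting_unit (f : I -> I -> A) (X : seq A) :
  mx_units c f -> {in X, forall x, J x} ->
  exists e, [/\ J e, e * e = e, forall p q, e * f p q = f p q * e &
    {in X, forall x, e * x = x /\ x * e = x}].
Proof.
move=> muf JX.
have [a [Ja aa fa aX]] := commuting_left_unit idJ regJ muf JX.
have [|b [Jb bb fb bX]] := @commuting_right_unit f (a :: X) muf.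
  by move=> x; rewrite inE => /predU1P[->|/JX].
have ab : a * b = a by apply: bX; rewrite inE eqxx.
(* Chosen so that 1 - e = (1 - b) (1 - a). Since [b] is also a right unit for [a], one gets a e = a
   and b e = b, whence idempotency. *)
exists (a + b - b * a); split.
- by apply: (tsidealB idJ); [apply: tsidealD | apply: (tsidealMl idJ)].
- have ae : a * (a + b - b * a) = a by rewrite mulrBr mulrDr mulrA ab aa addrK.
  have be : b * (a + b - b * a) = b.
    by rewrite mulrBr mulrDr mulrA bb addrAC subrr add0r.
  by rewrite mulrBl mulrDl -mulrA ae be.
- by move=> p q; rewrite mulrBl mulrBr mulrDl mulrDr fa fb -mulrA fa !mulrA fb.
- move=> x xX; have xb : x * b = x by apply: bX; rewrite inE xX orbT.
  rewrite mulrBl mulrBr mulrDl mulrDr -mulrA aX // mulrA xb addrK.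
  by rewrite addrAC subrr add0r.
Qed.

(* With u a left unit for the defects of b and e J = u J + sum b u J, the right
   ideal e J is stable under b and contains the defects, so compressing to the
   corner of 1 - e kills them. *)
Lemma lift_mx_units (b : I -> I -> A) :
  (forall p q, c p != c q -> b p q = 0) ->
  (forall p q r s, c p = c q -> c r = c s ->
     J (b p q * b r s - b p s *+ (q == r))) ->
  exists f : I -> I -> A, mx_units c f /\
    exists2 e, J e & forall p q, f p q = (1 - e) * b p q * (1 - e).
Proof.
move=> b0 bM.
(* The value zero where [bM] gives no information keeps all of [codom d] inside [J]. *)
pose d (t : (I * I) * (I * I)) :=
  if (c t.1.1 == c t.1.2) && (c t.2.1 == c t.2.2) then
    b t.1.1 t.1.2 * b t.2.1 t.2.2 - b t.1.1 t.2.2 *+ (t.1.2 == t.2.1) else 0.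
have [x|u [Ju uu ud _]] := @fg_right_ideal_idem A J idJ regJ (codom d).
  case/codomP=> -[[p q] [r s]] ->; rewrite /d /=.
  by case: ifP => [/andP[/eqP ? /eqP ?]|_]; [apply: bM | apply: (tsideal0 idJ)].
pose Y := u :: codom (fun t : I * I => b t.1 t.2 * u).
have [y|e [Je ee eY minE]] := @fg_right_ideal_idem A J idJ regJ Y.
  by rewrite inE => /predU1P[->|/codomP[t ->]] //; apply: (tsidealMl idJ).
have eu : e * u = u by apply: eY; rewrite inE eqxx.
have ebu p q : e * (b p q * u) = b p q * u.
  by apply: eY; rewrite inE (codom_f (fun t : I * I => b t.1 t.2 * u) (p, q)) orbT.
have ud' p q r s : c p = c q -> c r = c s ->
    let x := b p q * b r s - b p s *+ (q == r) in u * x = x.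
  move=> pq rs /=; have := ud _ (codom_f d ((p, q), (r, s))).
  by rewrite /d /= pq rs !eqxx.
have ebe p q : e * (b p q * e) = b p q * e.
  have: forall p q, e * (b p q * e) = b p q * e; last exact.
  apply: (minE (fun z => forall p q, e * (b p q * z) = b p q * z)) => //.
  - by move=> *; rewrite !mulr0.
  - by move=> x y Px Py r s; rewrite !mulrBr Px Py.
  - by move=> x a Px r s; rewrite !mulrA -(mulrA e) Px.
  move=> y; rewrite inE => /predU1P[->|/codomP[[r s] ->]] {}p {}q //=.
  have [pq|/eqP/b0 ->] := (c p =P c q); last by rewrite !mul0r mulr0.
  have [rs|/eqP/b0 ->] := (c r =P c s); last by rewrite mul0r !mulr0.
  rewrite (mulrA (b p q)) -[b p q * b r s](subrK (b p s *+ (q == r))) mulrDl.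
  rewrite -(ud' _ _ _ _ pq rs) mulrDr -!(mulrA u) (mulrA e) eu; congr (_ + _).
  by case: eqP => _; rewrite ?mulr1n ?mulr0n ?ebu // mul0r mulr0.
exists (fun p q => (1 - e) * b p q * (1 - e)); split; last by exists e.
split=> [p q /b0 ->|p q r s pq rs]; first by rewrite mulr0 mul0r.
have [w wE] : exists w, w = 1 - e by exists (1 - e).
have ww : w * w = w by rewrite wE mulrBl mul1r mulrBr mulr1 ee subrr subr0.
have wu : w * u = 0 by rewrite wE mulrBl mul1r eu subrr.
have we : w * e = 0 by rewrite wE mulrBl mul1r ee subrr.
(* Stability gives w b e = w e b e = 0. So the product of two compressions is w (b b) w, and w kills
   the defect of b b, which is fixed by [u], because w u = 0. *)
have wb : w * b p q * w = w * b p q.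
  by rewrite {2}wE mulrBr mulr1 -mulrA -ebe (mulrA w e) we mul0r subr0.
rewrite -wE !mulrA -(mulrA _ w w) ww wb -(mulrA w _ (b r s)).
rewrite -[b p q * b r s](subrK (b p s *+ (q == r))) mulrDr mulrDl.
by rewrite -(ud' _ _ _ _ pq rs) !mulrA wu !mul0r add0r mulrnAr mulrnAl.
Qed.

End TwoSided.

(** * Extensions of matricial algebras inside a unital algebra *)

Section MatrixFamilies.
Variables (K : fieldType) (k : nat) (n : 'I_k -> nat).
Local Notation T := {i : 'I_k & 'I_(n i)}.

(** Comparing indices in the sigma type avoids casts between blocks; the family is zero when p and q
    have different tags. *)
Definition delta_fam (p q : T) : forall i, 'M[K]_(n i) :=
  fun i => \matrix_(a, b) ((Tagged (fun i => 'I_(n i)) a == p)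
                           && (Tagged (fun i => 'I_(n i)) b == q))%:R.

Lemma delta_famM (p q r s : T) i : tag p = tag q ->
  delta_fam p q i *m delta_fam r s i = delta_fam p s i *+ (q == r).
Proof.
move=> pq; apply/matrixP=> a d; rewrite mulmxnE !mxE.
under eq_bigr => b _ do rewrite !mxE.
have [<-{r}|qr] := eqVneq q r; last first.
  rewrite big1 ?mulr0n // => b _; case: (eqVneq _ q) => [->|_].
    by rewrite (negPf qr) mulr0.
  by rewrite andbF mul0r.
have [ap|ap] := eqVneq _ p; last by rewrite big1 // => b _; rewrite mul0r.
case: q pq => j b /=; rewrite -ap /= => ij; move: b; rewrite -ij => b.
rewrite (bigD1 b) //= eqxx mul1r big1 ?addr0 // => b' bb'.
by rewrite eq_Tagged /= (negPf bb') mul0r.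
Qed.

Lemma delta_fam_diag_neq0 (p : T) : delta_fam p p (tag p) != 0.
Proof.
apply/eqP => /matrixP/(_ (tagged p) (tagged p)); rewrite !mxE.
have -> : Tagged (fun i => 'I_(n i)) (tagged p) = p by case: p.
by rewrite eqxx => /eqP; rewrite oner_eq0.
Qed.

(** Each family is the sum of its entries times matrix units, so linear statements need only be
    checked on these. *)
Lemma matfam_ind (W : (forall i, 'M[K]_(n i)) -> Prop) :
  W (fun i => 0) -> (forall x y, W x -> W y -> W (fun i => x i + y i)) ->
  (forall a x, W x -> W (fun i => a *: x i)) ->
  (forall p q, tag p = tag q -> W (delta_fam p q)) -> forall x, W x.
Proof.
move=> W0 WD WZ Wd x.
have Wext y z : (forall i, y i = z i) -> W y -> W z.
  by move=> yz; rewrite (functional_extensionality_dep y z yz).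
have Wsum (U : finType) (F : U -> forall i, 'M[K]_(n i)) :
    (forall u, W (F u)) -> W (fun i => \sum_u F u i).
  move=> WF; elim: (index_enum U) => [|u s IHs].
    by apply: Wext W0 => i; rewrite big_nil.
  by apply: Wext (WD _ _ (WF u) IHs) => i; rewrite big_cons.
pose tg := Tagged (fun i => 'I_(n i)).
apply: (@Wext (fun i => \sum_j \sum_(a < n j) \sum_(b < n j)
    x j a b *: delta_fam (tg j a) (tg j b) i)).
  move=> i; apply/matrixP=> a b; rewrite summxE (bigD1 i) //= [X in _ + X]big1 ?addr0 => [|j ij]; last first.
    rewrite summxE big1 // => c _; rewrite summxE big1 // => d _.
    by rewrite !mxE -tag_eqE /tag_eq /= eq_sym (negPf ij) mulr0.
  rewrite summxE (bigD1 a) //= [X in _ + X]big1 ?addr0 => [|c ca]; last first.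
    rewrite summxE big1 // => d _.
    by rewrite !mxE eq_Tagged /= eq_sym (negPf ca) mulr0.
  rewrite summxE (bigD1 b) //= [X in _ + X]big1 ?addr0 => [|d db]; last first.
    by rewrite !mxE !eq_Tagged /= eqxx /= eq_sym (negPf db) mulr0.
  by rewrite !mxE !eqxx mulr1.
apply: (Wsum) => j; apply: (Wsum) => a; apply: (Wsum) => b.
by apply: (WZ); apply: Wd.
Qed.

End MatrixFamilies.

(** * Locally matricial ideals of a unital algebra *)

Section Algebras.
Variables (K : fieldType) (A : algType K).

Inductive lspan (I : Type) (E : I -> I -> A) : A -> Prop :=
  | lspan0 : lspan E 0
  | lspan_unit p q : lspan E (E p q)
  | lspanD x y : lspan E x -> lspan E y -> lspan E (x + y)
  | lspanZ a x : lspan E x -> lspan E (a *: x).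

Lemma sub_lspan (I I' : Type) (E : I -> I -> A) (E' : I' -> I' -> A) x :
  (forall p q, lspan E' (E p q)) -> lspan E x -> lspan E' x.
Proof.
move=> EE'; elim=> [|p q|{}x y _ ? _ ?|a {}x _ ?] //;
  [exact: lspan0 | exact: lspanD | exact: lspanZ].
Qed.

(** The identity family may go to an idempotent other than 1. *)
Record mat_hom k (n : 'I_k -> nat) (phi : matprod K n -> A) : Prop := MatHom {
  mat_homD : forall x y, phi (fun i => x i + y i) = phi x + phi y;
  mat_homZ : forall a x, phi (fun i => a *: x i) = a *: phi x;
  mat_homM : forall x y, phi (fun i => x i *m y i) = phi x * phi y }.

Lemma mat_hom0 k (n : 'I_k -> nat) (phi : matprod K n -> A) :
  mat_hom phi -> phi (fun i => 0) = 0.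
Proof.
move=> hphi; rewrite -[RHS](scale0r (phi (fun i => 0))) -(mat_homZ hphi).
by congr phi; apply: functional_extensionality_dep => i /=; rewrite scaler0.
Qed.

Definition locally_mat (J : A -> Prop) : Prop :=
  forall s : seq A, {in s, forall x, J x} ->
  exists k (n : 'I_k -> nat) (phi : matprod K n -> A),
    [/\ mat_hom phi, injective phi, forall x, J (phi x) &
        {in s, forall x, exists y, phi y = x}].

(** Regularity concerns one element at a time, and each matrix block has the generalized inverse
    [pinvmx]. *)
Lemma locally_mat_regular (J : A -> Prop) : locally_mat J -> regular_ideal J.
Proof.
move=> lmJ x Jx; have [y|k [n [phi [hphi _ Jphi sphi]]]] := lmJ [:: x].
  by rewrite inE => /eqP ->.
have [|y <-] := sphi x; first by rewrite inE.
exists (phi (fun i => pinvmx (y i))); first exact: Jphi.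
rewrite -!(mat_homM hphi); congr phi; apply: functional_extensionality_dep => i /=.
exact: mulmxKpV.
Qed.

(** With the full rank factorization e = C R, idempotency reads C (R C) R = C R; cancel C on the
    left and R on the right. *)
Lemma idem_row_col_base (m : nat) (e : 'M[K]_m) :
  e *m e = e -> row_base e *m col_base e = 1%:M.
Proof.
move=> ee; apply: (row_full_inj (col_base_full e)).
apply: (row_free_inj (row_base_free e)).
by rewrite mulmx1 mulmxA mulmx_base -mulmxA mulmx_base.
Qed.

(** Factoring the preimage of [e] as cb rb with rb cb = 1 identifies the corner with matrices of
    size the rank, through x -> cb x rb. A rank may be zero, hence matrix units instead of
    [matprod], whose blocks are nonempty. *)
Lemma locally_mat_corner (J : A -> Prop) (e : A) (s : seq A) :
  locally_mat J -> J e -> e * e = e ->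
  {in s, forall x, J x /\ e * x * e = x} ->
  exists (I L : finType) (c : I -> L) (E : I -> I -> A),
    [/\ mx_units c E, forall p, E p p != 0,
        forall p q, [/\ J (E p q), e * E p q = E p q & E p q * e = E p q] &
        {in s, forall x, lspan E x}].
Proof.
move=> lmJ Je ee sJ.
have [x|k [n [phi [hphi iphi Jphi sphi]]]] := lmJ (e :: s).
  by rewrite inE => /predU1P[->|/sJ[]].
have [|eps epsE] := sphi e; first by rewrite inE eqxx.
have epsM i : eps i *m eps i = eps i.
  move: ee; rewrite -epsE -(mat_homM hphi) => /iphi.
  by move/(congr1 (fun f : matprod K n => f i)).
have [r [cb [rb [rcb crb]]]] : exists (r : 'I_k -> nat)
    (cb : forall i, 'M[K]_((n i).+1, r i)) (rb : forall i, 'M[K]_(r i, (n i).+1)),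
    (forall i, rb i *m cb i = 1%:M) /\ (forall i, cb i *m rb i = eps i).
  exists (fun i => \rank (eps i)), (fun i => col_base (eps i)).
  exists (fun i => row_base (eps i)).
  by split=> i; [apply: idem_row_col_base | apply: mulmx_base].
pose psi (x : forall i, 'M[K]_(r i)) : A := phi (fun i => cb i *m x i *m rb i).
have psiM x y : psi x * psi y = psi (fun i => x i *m y i).
  rewrite /psi -(mat_homM hphi); congr phi.
  apply: functional_extensionality_dep => i /=.
  by rewrite !mulmxA -(mulmxA _ (rb i)) rcb mulmx1.
have psi0 : psi (fun=> 0) = 0.
  rewrite /psi -[RHS](mat_hom0 hphi); congr phi.
  by apply: functional_extensionality_dep => i /=; rewrite mulmx0 mul0mx.
have epsi x : e * psi x = psi x.
  rewrite /psi -epsE -(mat_homM hphi); congr phi.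
  apply: functional_extensionality_dep => i /=.
  by rewrite -crb !mulmxA -(mulmxA (cb i) (rb i)) rcb mulmx1.
have psie x : psi x * e = psi x.
  rewrite /psi -epsE -(mat_homM hphi); congr phi.
  apply: functional_extensionality_dep => i /=.
  by rewrite -crb !mulmxA -(mulmxA _ (rb i) (cb i)) rcb mulmx1.
pose E (p q : {i : 'I_k & 'I_(r i)}) : A :=
  if tag p == tag q then psi (delta_fam K p q) else 0.
exists {i : 'I_k & 'I_(r i)}, 'I_k, tag, E; split.
- split=> [p q|p q u v pq uv]; first by rewrite /E => /negPf ->.
  rewrite /E pq uv !eqxx psiM; have [qu|qu] := eqVneq q u.
    rewrite -uv -qu eqxx mulr1n; congr psi; apply: functional_extensionality_dep => i /=.
    by rewrite delta_famM ?eqxx.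
  rewrite mulr0n -[RHS]psi0; congr psi; apply: functional_extensionality_dep => i /=.
  by rewrite delta_famM // (negPf qu).
(* Sandwiching between rb and cb recovers the nonzero diagonal matrix unit. *)
- move=> p; rewrite /E eqxx; apply/eqP; rewrite -(mat_hom0 hphi) => /iphi.
  move/(congr1 (fun f : matprod K n => rb (tag p) *m f (tag p) *m cb (tag p))).
  rewrite !mulmxA mulmx0 mul0mx rcb mul1mx -mulmxA rcb mulmx1.
  by apply/eqP; apply: delta_fam_diag_neq0.
- move=> p q; rewrite /E; case: eqP => _; first by split; [exact: Jphi| |].
  by rewrite mulr0 mul0r -(mat_hom0 hphi); split.
move=> x xs; have [|y yE] := sphi x; first by rewrite inE xs orbT.
have [_ exe] := sJ x xs.
(* As x = e x e, its preimage y may be replaced by cb (rb y cb) rb. *)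
have -> : x = psi (fun i => rb i *m y i *m cb i).
  rewrite -exe -epsE -yE -!(mat_homM hphi); congr phi.
  by apply: functional_extensionality_dep => i /=; rewrite -!crb !mulmxA.
apply: (@matfam_ind K k r (fun x => lspan E (psi x))).
- by rewrite psi0; apply: lspan0.
- move=> u v Eu Ev.
  suff -> : psi (fun i => u i + v i) = psi u + psi v by apply: lspanD.
  rewrite /psi -(mat_homD hphi); congr phi.
  by apply: functional_extensionality_dep => i /=; rewrite mulmxDr mulmxDl.
- move=> a u Eu.
  suff -> : psi (fun i => a *: u i) = a *: psi u by apply: lspanZ.
  rewrite /psi -(mat_homZ hphi); congr phi.
  by apply: functional_extensionality_dep => i /=; rewrite -scalemxAr -scalemxAl.
- by move=> p q pq; have := lspan_unit E p q; rewrite /E pq eqxx.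
Qed.

(* psi is an injective homomorphism modulo J, i.e. a set-theoretic lift of an
   embedding of a matricial algebra into the quotient by J. *)
Record mat_hom_mod (J : A -> Prop) k (n : 'I_k -> nat) (psi : matprod K n -> A) :
    Prop := MatHomMod {
  mat_hom_modD : forall x y, J (psi (fun i => x i + y i) - (psi x + psi y));
  mat_hom_modZ : forall a x, J (psi (fun i => a *: x i) - a *: psi x);
  mat_hom_modM : forall x y, J (psi (fun i => x i *m y i) - psi x * psi y);
  mat_hom_mod_inj : forall x, J (psi x) -> forall i, x i = 0 }.

Definition locally_mat_mod (J S : A -> Prop) : Prop :=
  forall s : seq A, {in s, forall x, S x} ->
  exists k (n : 'I_k -> nat) (psi : matprod K n -> A),
    [/\ mat_hom_mod J psi, forall x, S (psi x) &
        {in s, forall x, exists y, J (x - psi y)}].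

(** Local matriciality through matrix units: a nonvanishing diagonal makes the units within blocks
    independent. This form glues easily along disjoint index types. *)
Definition locally_mx_units (S : A -> Prop) : Prop :=
  forall s : seq A, {in s, forall x, S x} ->
  exists (I L : finType) (c : I -> L) (E : I -> I -> A),
    [/\ mx_units c E, forall p, E p p != 0, forall p q, S (E p q) &
        {in s, forall x, lspan E x}].

(** * Gluing lifted matrix units to a corner of the ideal *)

Section Extension.
Variables J S : A -> Prop.
Hypotheses (idJ : two_sided_ideal J) (idS : two_sided_ideal S).
Hypothesis sJS : forall x, J x -> S x.
Hypotheses (lmJ : locally_mat J) (lmS : locally_mat_mod J S).

Lemma tsidealZ a x : J x -> J (a *: x).
Proof. by move=> Jx; rewrite -mulr_algl; apply: (tsidealMl idJ). Qed.

Lemma tsideal_trans y x z : J (x - y) -> J (y - z) -> J (x - z).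
Proof. by move=> xy yz; rewrite -(subrKA y); apply: tsidealD. Qed.

(** The corrected units differ from the lifts by (1 - e) b e + e b, which lies in [J]; so spanning
    modulo [J] and a diagonal outside [J] are inherited from [psi]. *)
Lemma lifted_mx_units (s : seq A) : {in s, forall x, S x} ->
  exists (I L : finType) (c : I -> L) (f : I -> I -> A),
    [/\ mx_units c f, forall p, ~ J (f p p), forall p q, S (f p q) &
        {in s, forall x, exists2 y, lspan f y & J (x - y)}].
Proof.
move=> Ss; have [k [n [psi [hpsi Spsi spsi]]]] := lmS Ss.
pose I := {i : 'I_k & 'I_(n i).+1}.
pose b (p q : I) : A := if tag p == tag q then psi (delta_fam K p q) else 0.
(* [psi] is only a lift: it sends zero into [J], not necessarily to 0. *)
have psi0 : J (psi (fun i => 0)).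
  have /tsidealN-/(_ idJ) := mat_hom_modD hpsi (fun=> 0) (fun=> 0).
  rewrite opprB; congr J.
  have -> : (fun i => 0 + 0) = (fun i => 0) :> matprod K n.
    by apply: functional_extensionality_dep => i /=; rewrite addr0.
  by rewrite addrK.
have [|p q r t pq rt|f [muf [e Je fE]]] :=
    @lift_mx_units A J idJ (locally_mat_regular lmJ) I 'I_k tag b.
- by move=> p q; rewrite /b => /negPf ->.
- have := mat_hom_modM hpsi (delta_fam K p q) (delta_fam K r t).
  rewrite /b pq rt !eqxx => /(tsidealN idJ); rewrite opprB => H.
  apply: tsideal_trans H _; have [qr|qr] := eqVneq q r.
    rewrite qr rt eqxx.
    have -> : (fun i => delta_fam K p r i *m delta_fam K r t i) = delta_fam K p t.
      apply: functional_extensionality_dep => i /=.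
      by rewrite delta_famM ?eqxx // pq qr.
    by rewrite subrr; apply: (tsideal0 idJ).
  rewrite mulr0n subr0.
  have -> // : (fun i => delta_fam K p q i *m delta_fam K r t i) = (fun=> 0).
  apply: functional_extensionality_dep => i /=.
  by rewrite delta_famM // (negPf qr).
have fb p q : J (b p q - f p q).
  rewrite fE mulrBr mulr1 opprB addrCA; apply: tsidealD => //.
    by apply: (tsidealMl idJ).
  rewrite mulrBl mul1r subKr.
  exact: (tsidealMr idJ).
have Sb p q : S (b p q).
  by rewrite /b; case: eqP => _; [apply: Spsi | apply: (tsideal0 idS)].
exists I, 'I_k, tag, f; split=> //.
- move=> p Jf; have Jb : J (b p p) by rewrite -(subrK (f p p) (b p p)); apply: tsidealD.
  move: Jb; rewrite /b eqxx => /(mat_hom_mod_inj hpsi)/(_ (tag p))/eqP.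
  by apply/negP; apply: delta_fam_diag_neq0.
- move=> p q; rewrite -[f p q](subKr (b p q)); apply: (tsidealB idS) => //.
  exact: sJS.
move=> x /spsi[y xy].
suff [z fz yz] : exists2 z, lspan f z & J (psi y - z).
  by exists z => //; apply: tsideal_trans xy yz.
move: y {xy}; apply: (@matfam_ind K k (fun i => (n i).+1)).
- by exists 0; [apply: lspan0 | rewrite subr0].
- move=> u v [z fz uz] [w fw vw]; exists (z + w); first exact: lspanD.
  apply: tsideal_trans (mat_hom_modD hpsi u v) _.
  by rewrite opprD addrACA; apply: tsidealD.
- move=> a u [z fz uz]; exists (a *: z); first exact: lspanZ.
  apply: tsideal_trans (mat_hom_modZ hpsi a u) _.
  by rewrite -scalerBr; apply: tsidealZ.
- move=> p q pq; exists (f p q); first exact: lspan_unit.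
  by have := fb p q; rewrite /b pq eqxx.
Qed.

Lemma locally_mx_units_extension : locally_mx_units S.
Proof.
move=> s Ss; have [I [L [c [f [muf nJf Sf sf]]]]] := lifted_mx_units Ss.
(* [X] collects the errors in approximating [s] by the span of [f]. *)
have [X JX sX] : exists2 X : seq A, {in X, forall x, J x} &
    {in s, forall x, exists2 y, lspan f y & x - y \in X}.
  elim: s {Ss} sf => [|x s IHs] sf; first by exists [::].
  have [y ys|X JX sX] := IHs; first by apply: sf; rewrite inE ys orbT.
  have [|y fy xy] := sf x; first by rewrite inE eqxx.
  exists ((x - y) :: X) => [z|z]; rewrite inE => /predU1P[->|] //.
  - exact: JX.
  - by exists y => //; rewrite inE eqxx.
  - by move=> /sX[w fw zw]; exists w => //; rewrite inE zw orbT.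
have [e [Je ee ef eX]] := commuting_unit idJ (locally_mat_regular lmJ) muf JX.
(* With e f in the corner, f = (1 - e) f + e f stays in the joint span. *)
pose Y := X ++ codom (fun t : I * I => e * f t.1 t.2).
have [x|I' [L' [c' [E [muE E0 SE sE]]]]] := @locally_mat_corner J e Y lmJ Je ee.
  rewrite mem_cat => /orP[xX|/codomP[[p q] ->]].
    by split; [apply: JX | have [-> ->] := eX x xX].
  split; first by apply: (tsidealMr idJ).
  by rewrite mulrA ee -mulrA -ef mulrA ee.
pose g p q := f p q - e * f p q.
have eg p q : e * g p q = 0 by rewrite mulrBr mulrA ee subrr.
have ge p q : g p q * e = 0 by rewrite mulrBl -mulrA -ef mulrA ee subrr.
have gJ p q : J (f p q - g p q) by rewrite subKr; apply: (tsidealMr idJ).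
(* A block sum: [E] lives in the corner of [e], which annihilates [g] on both sides. *)
pose G (p q : I' + I) : A := match p, q with
  | inl p, inl q => E p q | inr p, inr q => g p q | _, _ => 0 end.
pose cG (p : I' + I) : L' + L := match p with inl p => inl (c' p) | inr p => inr (c p) end.
have sGE x : lspan E x -> lspan G x.
  by apply: sub_lspan => p q; apply: (lspan_unit G (inl p) (inl q)).
have sGf x : lspan f x -> lspan G x.
  apply: sub_lspan => p q; rewrite -(subrK (e * f p q) (f p q)); apply: lspanD.
    exact: (lspan_unit G (inr p) (inr q)).
  apply: sGE; apply: sE; rewrite mem_cat.
  by rewrite (codom_f (fun t : I * I => e * f t.1 t.2) (p, q)) orbT.
exists (I' + I)%type, (L' + L)%type, cG, G; split.
- split=> [[p|p] [q|q] // pq | [p|p] [q|q] // [r|r] [t|t] //= pq rt].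
  + exact: (mx_units0 muE).
  + by rewrite /G /g (mx_units0 muf) // mulr0 subrr.
  + by rewrite (mx_unitsM muE) //; [case: pq | case: rt].
  + have [_ _ <-] := SE p q.
    by rewrite -mulrA eg mulr0 mul0rn.
  + have [_ <- _] := SE r t.
    by rewrite mulrA ge mul0r mul0rn.
  + case: pq rt => pq [rt].
    rewrite {2}/g mulrBr mulrA ge mul0r subr0 /g mulrBl -mulrA (mx_unitsM muf) //.
    by rewrite mulrnAr -mulrnBl.
(* If g p p vanished, f p p would equal e f p p and lie in [J]. *)
- case=> p //=; apply/eqP => gp; apply: (nJf p).
  by rewrite -(subr0 (f p p)) -gp.
- case=> [p|p] [q|q] /=; try exact: (tsideal0 idS).
    by apply: sJS; case: (SE p q).
  by apply: (tsidealB idS) => //; apply: (tsidealMl idS).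
move=> x /sX[y fy xy]; rewrite -(subrK y x); apply: lspanD; last exact: sGf.
by apply: sGE; apply: sE; rewrite mem_cat xy.
Qed.

End Extension.
End Algebras.

(** * From matrix units to products of matrix algebras *)

Section MxUnitsToMatricial.
Variables (K : fieldType) (A : algType K) (I L : finType) (c : I -> L).

(** Only labels with a nonempty fiber count as blocks, so that each fiber size is a successor, as
    [matprod] demands. *)
Lemma fiber_enumeration : exists k (n : 'I_k -> nat)
    (g : {i : 'I_k & 'I_(n i).+1} -> I),
  [/\ bijective g & forall p q, (c (g p) == c (g q)) = (tag p == tag q)].
Proof.
pose T := {l : L | [exists p, c p == l]}.
pose F (i : 'I_#|{: T}|) := [set p | c p == val (enum_val i)].
have F0 i : #|F i|.-1.+1 = #|F i|.
  rewrite prednK //; apply/card_gt0P.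
  by have /existsP[p cp] := valP (enum_val i); exists p; rewrite inE.
pose g (p : {i : 'I_#|{: T}| & 'I_(#|F i|.-1).+1}) : I :=
  enum_val (cast_ord (F0 (tag p)) (tagged p)).
have cg p : c (g p) = val (enum_val (tag p)).
  by have := enum_valP (cast_ord (F0 (tag p)) (tagged p)); rewrite inE => /eqP.
exists #|{: T}|, (fun i => #|F i|.-1), g; split; last first.
  by move=> p q; rewrite !cg (inj_eq val_inj) (inj_eq enum_val_inj).
have gI : injective g.
  move=> p q pq; have := congr1 c pq; rewrite !cg => /val_inj/enum_val_inj.
  case: p q pq => i a [j b] /= pq ij; case: j / ij b pq => b.
  by move=> /enum_val_inj/cast_ord_inj /= ->.
have gS p : exists q, g q == p.
  have Tp : [exists q, c q == c p] by apply/existsP; exists p.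
  pose i := enum_rank (Sub (c p) Tp : T).
  have Fp : p \in F i by rewrite inE enum_rankK.
  exists (Tagged (fun i => 'I_(#|F i|.-1).+1) (cast_ord (esym (F0 i)) (enum_rank_in Fp p))).
  by rewrite /g /= cast_ordKV enum_rankK_in.
exists (fun p => xchoose (gS p)) => p; last exact/eqP/(xchooseP (gS p)).
exact/gI/eqP/(xchooseP (gS (g p))).
Qed.

Lemma mx_units_matprod (E : I -> I -> A) :
  mx_units c E -> (forall p, E p p != 0) ->
  exists k (n : 'I_k -> nat) (phi : matprod K n -> A),
    [/\ mat_hom phi, injective phi, forall y, lspan E (phi y) &
        forall x, lspan E x -> exists y, phi y = x].
Proof.
move=> muE E0; have [k [n [g [gB cg]]]] := fiber_enumeration.
have gI := bij_inj gB; case: gB => h _ gh.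
pose tg i (a : 'I_(n i).+1) := Tagged (fun i => 'I_(n i).+1) a.
pose phi (x : matprod K n) : A :=
  \sum_i \sum_a \sum_b x i a b *: E (g (tg i a)) (g (tg i b)).
pose dl := @delta_fam K k (fun i => (n i).+1).
have phiD x y : phi (fun i => x i + y i) = phi x + phi y.
  rewrite /phi -big_split; apply: eq_bigr => i _ /=.
  rewrite -big_split; apply: eq_bigr => a _ /=.
  by rewrite -big_split; apply: eq_bigr => b _ /=; rewrite mxE scalerDl.
have phiZ z x : phi (fun i => z *: x i) = z *: phi x.
  rewrite /phi scaler_sumr; apply: eq_bigr => i _ /=.
  rewrite scaler_sumr; apply: eq_bigr => a _ /=.
  by rewrite scaler_sumr; apply: eq_bigr => b _ /=; rewrite mxE scalerA.
have phi0 : phi (fun=> 0) = 0.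
  by rewrite /phi big1 // => i _; rewrite big1 // => a _; rewrite big1 // => b _;
     rewrite mxE scale0r.
have phid p q : tag p = tag q -> phi (dl p q) = E (g p) (g q).
  case: p q => i a [j b] /= ij; case: j / ij b => b.
  rewrite /phi (bigD1 i) //= [X in _ + X]big1 ?addr0 => [|j ij]; last first.
    rewrite big1 // => u _; rewrite big1 // => v _.
    by rewrite mxE -tag_eqE /tag_eq /= (negPf ij) scale0r.
  rewrite (bigD1 a) //= [X in _ + X]big1 ?addr0 => [|u ua]; last first.
    by rewrite big1 // => v _; rewrite mxE eq_Tagged /= (negPf ua) scale0r.
  rewrite (bigD1 b) //= [X in _ + X]big1 ?addr0 => [|v vb]; last first.
    by rewrite mxE !eq_Tagged /= (negPf vb) andbF scale0r.
  by rewrite mxE !eqxx scale1r.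
have cgE p q : tag p = tag q -> c (g p) = c (g q).
  by move=> pq; apply/eqP; rewrite cg pq.
(* Both sides are bilinear, so multiplicativity reduces to matrix units in each argument. *)
have hphi : mat_hom phi.
  split=> // x y; move: x y.
  apply: (@matfam_ind K k (fun i => (n i).+1)
    (fun x => forall y, phi (fun i => x i *m y i) = phi x * phi y)).
  - move=> y; rewrite phi0 mul0r -[RHS]phi0; congr phi.
    by apply: functional_extensionality_dep => i; rewrite mul0mx.
  - move=> x x' xP x'P y; rewrite phiD mulrDl -xP -x'P -phiD; congr phi.
    by apply: functional_extensionality_dep => i; rewrite mulmxDl.
  - move=> z x xP y; rewrite phiZ -scalerAl -xP -phiZ; congr phi.
    by apply: functional_extensionality_dep => i; rewrite scalemxAl.
  move=> p q pq.
  apply: (@matfam_ind K k (fun i => (n i).+1)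
    (fun y => phi (fun i => dl p q i *m y i) = phi (dl p q) * phi y)).
  - rewrite phi0 mulr0 -[RHS]phi0; congr phi.
    by apply: functional_extensionality_dep => i; rewrite mulmx0.
  - move=> y y' yP y'P; rewrite phiD mulrDr -yP -y'P -phiD; congr phi.
    by apply: functional_extensionality_dep => i; rewrite mulmxDr.
  - move=> z y yP; rewrite phiZ -scalerAr -yP -phiZ; congr phi.
    by apply: functional_extensionality_dep => i; rewrite scalemxAr.
  move=> r s rs; rewrite -/(dl r s) !phid // (mx_unitsM muE) ?(cgE p q) ?(cgE r s) //.
  rewrite (inj_eq gI); have [qr|qr] := eqVneq q r.
    rewrite mulr1n -phid ?pq ?qr //; congr phi.
    by apply: functional_extensionality_dep => i; rewrite delta_famM ?pq ?eqxx ?qr.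
  rewrite mulr0n -[RHS]phi0; congr phi.
  by apply: functional_extensionality_dep => i; rewrite delta_famM // (negPf qr).
(* E p q E q p = E p p is nonzero. With the next identity, which reads off the entries of x from phi
   x, this yields injectivity. *)
have E_neq0 p q : c p = c q -> E p q != 0.
  move=> pq; apply: contraNneq (E0 p) => Epq.
  by rewrite -(mx_unitsMid muE (q := q)) // Epq mul0r.
have coef i (a b : 'I_(n i).+1) x :
    E (g (tg i a)) (g (tg i a)) * phi x * E (g (tg i b)) (g (tg i b)) =
    x i a b *: E (g (tg i a)) (g (tg i b)).
  move: x; apply: (@matfam_ind K k (fun i => (n i).+1)).
  - by rewrite phi0 mulr0 mul0r mxE scale0r.
  - by move=> x y xP yP; rewrite phiD mulrDr mulrDl xP yP mxE scalerDl.
  - by move=> z x xP; rewrite phiZ -scalerAr -scalerAl xP mxE scalerA.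
  move=> p q pq; rewrite -/(dl p q) phid // (mx_unitsM muE) ?(cgE p q) //.
  rewrite (inj_eq gI) mxE; have [ap|_] := eqVneq _ p; last first.
    by rewrite mulr0n mul0r scale0r.
  rewrite mulr1n (mx_unitsM muE) ?(inj_eq gI) ?(eq_sym q) //; last first.
    by rewrite ap; apply: cgE.
  by case: eqP => _; rewrite ?scale1r ?scale0r.
exists k, n, phi; split=> //.
- move=> x y xy; apply: functional_extensionality_dep => i; apply/matrixP=> a b.
  have /eqP := coef i a b x; rewrite xy coef -subr_eq0 -scalerBl scaler_eq0.
  by rewrite (negPf (E_neq0 _ _ _)) ?orbF ?subr_eq0 ?(cgE (tg i a) (tg i b)) // => /eqP.
- apply: (@matfam_ind K k (fun i => (n i).+1)).
  + by rewrite phi0; apply: lspan0.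
  + by move=> x y; rewrite phiD; apply: lspanD.
  + by move=> z x; rewrite phiZ; apply: lspanZ.
  + by move=> p q pq; rewrite -/(dl p q) phid //; apply: lspan_unit.
move=> x; elim=> {x} [|p q|_ _ _ [x <-] _ [y <-]|z _ _ [x <-]].
- by exists (fun=> 0).
- have [pq|pq] := eqVneq (c p) (c q); last first.
    by exists (fun=> 0); rewrite phi0 (mx_units0 muE).
  exists (dl (h p) (h q)); rewrite phid ?gh //.
  by apply/eqP; rewrite -cg !gh pq.
- by exists (fun i => x i + y i).
- by exists (fun i => z *: x i).
Qed.

End MxUnitsToMatricial.

(** * Unitization *)

Section Unitization.
Variables (K : fieldType) (R : Type) (o : nalg_ops K R).

(** Tagging the carrier with the proof lets structure instances find the axioms in the type. *)
Definition nalg_module (HR : is_nalg o) : Type := R.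

Variable HR : is_nalg o.
Local Notation M := (nalg_module HR).

HB.instance Definition _ := gen_eqMixin M.
HB.instance Definition _ := gen_choiceMixin M.

Let naddA : associative (nadd o : M -> M -> M).
Proof. have [H _] := HR; exact: H. Qed.
Let naddC : commutative (nadd o : M -> M -> M).
Proof. have [_ [H _]] := HR; exact: H. Qed.
Let nadd0 : left_id (nzero o) (nadd o : M -> M -> M).
Proof. have [_ [_ [H _]]] := HR; exact: H. Qed.
Let naddN : left_inverse (nzero o) (nopp o) (nadd o : M -> M -> M).
Proof. have [_ [_ [_ [H _]]]] := HR; exact: H. Qed.

HB.instance Definition _ := GRing.isZmodule.Build M naddA naddC nadd0 naddN.

Let nscaleA (a b : K) (x : M) : nscale o a (nscale o b x) = nscale o (a * b) x.
Proof. have [_ [_ [_ [_ [_ [_ [H _]]]]]]] := HR; exact: H. Qed.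
Let nscale1 : left_id 1 (nscale o : K -> M -> M).
Proof. have [_ [_ [_ [_ [_ [_ [_ [H _]]]]]]]] := HR; exact: H. Qed.
Let nscaleDr : right_distributive (nscale o : K -> M -> M) +%R.
Proof. have [_ [_ [_ [_ [H _]]]]] := HR; exact: H. Qed.
Let nscaleDl (x : M) : {morph (nscale o : K -> M -> M)^~ x : a b / a + b}.
Proof. move=> a b; have [_ [_ [_ [_ [_ [H _]]]]]] := HR; exact: H. Qed.

HB.instance Definition _ :=
  GRing.Zmodule_isLmodule.Build K M nscaleA nscale1 nscaleDr nscaleDl.

Definition nalg_mul : M -> M -> M := nmul o.
Local Notation "x ** y" := (nalg_mul x y) (at level 40).

Let nmulA (x y z : M) : x ** (y ** z) = (x ** y) ** z.
Proof. have [_ [_ [_ [_ [_ [_ [_ [_ [H _]]]]]]]]] := HR; exact: H. Qed.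
Let nmulDr (x y z : M) : x ** (y + z) = x ** y + x ** z.
Proof. have [_ [_ [_ [_ [_ [_ [_ [_ [_ [H _]]]]]]]]]] := HR; exact: H. Qed.
Let nmulDl (x y z : M) : (x + y) ** z = x ** z + y ** z.
Proof. have [_ [_ [_ [_ [_ [_ [_ [_ [_ [_ [H _]]]]]]]]]]] := HR; exact: H. Qed.
Let nscaleAl (a : K) (x y : M) : a *: (x ** y) = (a *: x) ** y.
Proof. have [_ [_ [_ [_ [_ [_ [_ [_ [_ [_ [_ [H _]]]]]]]]]]]] := HR; exact: H. Qed.
Let nscaleAr (a : K) (x y : M) : a *: (x ** y) = x ** (a *: y).
Proof. have [_ [_ [_ [_ [_ [_ [_ [_ [_ [_ [_ [_ H]]]]]]]]]]]] := HR; exact: H. Qed.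
Let nmul0 (x : M) : x ** 0 = 0.
Proof. by rewrite -(scale0r (0 : M)) -nscaleAr !scale0r. Qed.
Let nmul0l (x : M) : 0 ** x = 0.
Proof. by rewrite -(scale0r (0 : M)) -nscaleAl !scale0r. Qed.

(** The pair (a, x) stands for a 1 + x; a unit is adjoined even if [R] has one. [K^o] makes the
    additive and linear structure that of a product of modules. *)
Definition unitization : Type := (K^o * M)%type.
HB.instance Definition _ := GRing.Lmodule.on unitization.

Definition unitization_one : unitization := (1, 0).
Definition unitization_mul (x y : unitization) : unitization :=
  (x.1 * y.1, x.1 *: y.2 + y.1 *: x.2 + x.2 ** y.2).

Let umulA : associative unitization_mul.
Proof.
move=> [a x] [b y] [d z]; congr pair; rewrite /= ?mulrA //.
rewrite !scalerDr !nmulDr !nmulDl !scalerA -!nscaleAl -!nscaleAr nmulA.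
rewrite -!addrA; congr (_ + _); rewrite [d * a]mulrC [d * b]mulrC.
congr (_ + _); rewrite addrCA; congr (_ + _).
by rewrite [RHS]addrCA; congr (_ + _); rewrite addrCA.
Qed.
Let umul1 : left_id unitization_one unitization_mul.
Proof.
by move=> [a x]; rewrite /unitization_mul /= mul1r scale1r scaler0 nmul0l !addr0.
Qed.
Let umulr1 : right_id unitization_one unitization_mul.
Proof.
by move=> [a x]; rewrite /unitization_mul /= mulr1 scale1r scaler0 nmul0 addr0 add0r.
Qed.
Let umulDl : left_distributive unitization_mul +%R.
Proof.
move=> [a x] [b y] [d z]; congr pair; rewrite /= ?mulrDl //.
by rewrite scalerDl scalerDr nmulDl [RHS]addrACA; congr (_ + _); rewrite addrACA.
Qed.
Let umulDr : right_distributive unitization_mul +%R.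
Proof.
move=> [a x] [b y] [d z]; congr pair; rewrite /= ?mulrDr //.
by rewrite scalerDl scalerDr nmulDr [RHS]addrACA; congr (_ + _); rewrite addrACA.
Qed.
Let uone_neq0 : unitization_one != 0.
Proof. by apply/eqP => -[/eqP]; rewrite oner_eq0. Qed.

HB.instance Definition _ := GRing.Zmodule_isNzRing.Build unitization
  umulA umul1 umulr1 umulDl umulDr uone_neq0.

Let uscaleAl (a : K) (x y : unitization) : a *: (x * y) = (a *: x) * y.
Proof.
congr pair; rewrite /= ?scalerAl //.
by rewrite !scalerDr !scalerA nscaleAl [y.1 * a]mulrC.
Qed.
HB.instance Definition _ := GRing.Lmodule_isLalgebra.Build K unitization uscaleAl.

Let uscaleAr (a : K) (x y : unitization) : a *: (x * y) = x * (a *: y).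
Proof.
congr pair; rewrite /= ?scalerAr //.
by rewrite !scalerDr !scalerA nscaleAr [x.1 * a]mulrC.
Qed.
HB.instance Definition _ := GRing.Lalgebra_isAlgebra.Build K unitization uscaleAr.


End Unitization.

(** * Transfer to the unitization *)

Section Transfer.
Variables (K : fieldType) (R : Type) (o : nalg_ops K R) (HR : is_nalg o).
Variable J : nideal o.
Local Notation A := (unitization HR).
Local Notation M := (nalg_module HR).

Definition unitization_in (x : R) : A := (0, x : M).

(** With [P] always true this is [R] itself inside its unitization. *)
Definition unitization_ideal (P : R -> Prop) : A -> Prop :=
  fun x => x.1 = 0 /\ P x.2.

Lemma unitization_ideal_in P x :
  unitization_ideal P x -> x = unitization_in x.2.
Proof. by case: x => a x [/= ->]. Qed.

Lemma unitization_inB (x y : M) :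
  unitization_in x - unitization_in y = unitization_in (x - y).
Proof. by congr pair; rewrite /= subr0. Qed.

Lemma unitization_inD x y :
  unitization_in x + unitization_in y = unitization_in (nadd o x y).
Proof. by congr pair; rewrite /= addr0. Qed.

Lemma unitization_inZ a x : a *: unitization_in x = unitization_in (nscale o a x).
Proof. by congr pair; rewrite /= scaler0. Qed.

Lemma unitization_inM x y :
  unitization_in x * unitization_in y = unitization_in (nmul o x y).
Proof. by congr pair; rewrite /= ?mulr0 // !scale0r !add0r. Qed.

(** The scalar part of a multiplier acts by scaling, so [J] must be a subspace as well as an
    ideal. *)
Lemma unitization_tsideal : two_sided_ideal (unitization_ideal J).
Proof.
have JD (x y : M) : J x -> J y -> J (x + y) by apply: nidlD.
have JZ a (x : M) : J x -> J (a *: x) by apply: nidlZ.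
have JN (x : M) : J x -> J (- x) by apply: nidlN.
split.
- by split=> //; apply: nidl0.
- move=> x y [x0 Jx] [y0 Jy]; split; first by rewrite /= x0 y0 subr0.
  by apply: JD => //; apply: JN.
- move=> a x [x0 Jx]; split; first by rewrite /= x0 mulr0.
  rewrite /= x0 scale0r addr0; apply: JD; first exact: JZ.
  exact: nidlMl.
- move=> a x [x0 Jx]; split; first by rewrite /= x0 mul0r.
  rewrite /= x0 scale0r add0r; apply: JD; first exact: JZ.
  exact: nidlMr.
Qed.

Lemma unitization_locally_mat :
  locally_matricial (ideal_ops J) -> locally_mat (unitization_ideal J).
Proof.
move=> lmJ s sJ.
have [t tP] : exists t : seq (ideal_sort J), {in s, forall x, exists2 y,
    List.In y t & x = unitization_in (proj1_sig y)}.
  elim: s sJ => [|x s IHs] sJ; first by exists [::].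
  have [y ys|t tP] := IHs; first by apply: sJ; rewrite inE ys orbT.
  have JAx : unitization_ideal J x by apply: sJ; rewrite inE eqxx.
  have xE := unitization_ideal_in JAx; have [_ Jx] := JAx.
  exists (exist _ (x.2 : R) Jx :: t) => y; rewrite inE => /predU1P[->|/tP[z zt ->]].
    by exists (exist _ (x.2 : R) Jx) => //; left.
  by exists z => //; right.
have [S [[_ [k [n [phi [[phiD [phiZ phiM]] [phiI phiS]]]]]] tS]] := lmJ t.
exists k, n, (fun x => unitization_in (proj1_sig (phi x))); split.
- split=> [x y|a x|x y]; rewrite ?unitization_inD ?unitization_inZ ?unitization_inM.
  + by rewrite phiD.
  + by rewrite phiZ.
  + by rewrite phiM.
- move=> x y [xy]; apply: phiI.
  by case: (phi x) (phi y) xy => u Ju [v Jv] /= uv; apply: eq_exist.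
- by move=> x; split=> //=; apply: proj2_sig.
- by move=> x /tP[y /tS/phiS[z zy] ->]; exists z; rewrite zy.
Qed.

Lemma ideal_sub_refl (x : R) : J (nadd o x (nopp o x)).
Proof.
have -> : nadd o x (nopp o x) = nzero o := subrr (x : M).
exact: nidl0.
Qed.

Lemma coset_eqP (x y : R) : coset J x = coset J y <-> J (nadd o x (nopp o y)).
Proof.
split=> [xy|xy].
  by rewrite -/(coset J x y) xy; apply: ideal_sub_refl.
have subl (u v w : M) : v - w = u - w - (u - v).
  by rewrite opprB addrCA addrAC subrr add0r.
have subr (u v w : M) : u - w = u - v + (v - w) by rewrite subrKA.
apply: functional_extensionality => z; apply: propext; split=> H; rewrite /coset.
- have -> : nadd o y (nopp o z) =
      nadd o (nadd o x (nopp o z)) (nopp o (nadd o x (nopp o y))) := subl x y z.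
  by apply: nidlD => //; apply: nidlN.
- have -> : nadd o x (nopp o z) =
      nadd o (nadd o x (nopp o y)) (nadd o y (nopp o z)) := subr x y z.
  exact: nidlD.
Qed.

Lemma qrepK (C : quot_sort J) : qclass J (qrep C) = C.
Proof.
case: C => C HC; apply: eq_exist; rewrite /qrep /=.
by case: ClassicalEpsilon.constructive_indefinite_description => x /= ->.
Qed.

Lemma qrep_class (x : R) : J (nadd o (qrep (qclass J x)) (nopp o x)).
Proof. by apply/coset_eqP; have [] := qrepK (qclass J x). Qed.

(** Choosing representatives turns [phi] into a set-theoretic lift. Quotient operations are computed
    on representatives, so each identity fails only by the difference between an element and the
    representative of its class. *)
Lemma unitization_locally_mat_mod :
  locally_matricial (quot_ops J) ->
  locally_mat_mod (unitization_ideal J) (unitization_ideal (fun=> True)).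
Proof.
move=> lmQ s sR.
have [S [[_ [k [n [phi [[phiD [phiZ phiM]] [phiI phiS]]]]]] tS]] :=
  lmQ (map (fun x : A => qclass J x.2) s).
exists k, n, (fun x => unitization_in (qrep (phi x))); split=> //.
- split=> [x y|a x|x y|x [_ /= Jx]].
  + rewrite unitization_inD unitization_inB phiD; split=> //; exact: qrep_class.
  + rewrite unitization_inZ unitization_inB phiZ; split=> //; exact: qrep_class.
  + rewrite unitization_inM unitization_inB phiM; split=> //; exact: qrep_class.
  have class0 z : J z -> qclass J z = qclass J (nzero o).
    move=> Jz; apply: eq_exist; apply/coset_eqP.
    by have -> : nadd o z (nopp o (nzero o)) = z := subr0 (z : M).
  (* [is_alg_hom] has no clause for zero, so the zero family is written as 0 times the x at hand,
     whose representative lies in [J]. *)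
  have phi0 : phi (fun=> 0) = qclass J (nzero o).
    have -> : (fun=> 0) = (fun i => 0 *: x i) :> matprod K n.
      by apply: functional_extensionality_dep => i; rewrite scale0r.
    by rewrite phiZ; apply: class0; apply: nidlZ.
  have: phi x = phi (fun=> 0) by rewrite phi0 -[LHS]qrepK; apply: class0.
  by move=> /phiI -> i.
move=> x xs; have: List.In (qclass J x.2) (map (fun x : A => qclass J x.2) s).
  elim: s xs {sR tS} => // y s IHs; rewrite inE => /predU1P[->|/IHs]; [by left|by right].
move=> /tS/phiS[y yE]; exists y; rewrite yE (unitization_ideal_in (sR x xs)) /=.
rewrite unitization_inB; split=> //=.
by apply/coset_eqP; have [] := qrepK (qclass J x.2).
Qed.

End Transfer.

Arguments unitization_ideal {K R o} HR P x.

Lemma locally_mx_units_matricial (K : fieldType) (R : Type) (o : nalg_ops K R)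
    (HR : is_nalg o) :
  locally_mx_units (unitization_ideal HR (fun=> True)) -> locally_matricial o.
Proof.
move=> lmR s.
have [x|I [L [c [E [muE E0 RE sE]]]]] := lmR (map (unitization_in HR) s).
  by elim: s => // y s IHs; rewrite inE => /predU1P[->|/IHs].
have [k [n [phi [hphi iphi Ephi sphi]]]] := mx_units_matprod muE E0.
(* The span of [E] has zero scalar part, so [phi] factors through [R]. *)
have phi_in x : phi x = unitization_in HR (phi x).2.
  apply: (@unitization_ideal_in _ _ _ _ (fun=> True)); split=> //.
  elim: (Ephi x) => [|p q|y z _ IHy _ IHz|a y _ IHy] //=; first by case: (RE p q).
  - by rewrite IHy IHz addr0.
  - by rewrite IHy scaler0.
pose psi x : R := (phi x).2.
have psiD x y : psi (fun i => x i + y i) = nadd o (psi x) (psi y).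
  by rewrite /psi (mat_homD hphi).
have psiZ a x : psi (fun i => a *: x i) = nscale o a (psi x).
  by rewrite /psi (mat_homZ hphi).
have psiM x y : psi (fun i => x i *m y i) = nmul o (psi x) (psi y).
  by rewrite /psi (mat_homM hphi) phi_in (phi_in y) unitization_inM.
have psi0 : psi (fun=> 0) = nzero o by rewrite /psi (mat_hom0 hphi).
exists (fun x => exists y, psi y = x); split; last first.
  move=> x xs; have: unitization_in HR x \in map (unitization_in HR) s.
    by elim: s xs {sE} => // y s IHs [->|/IHs]; rewrite inE ?eqxx // => ->; rewrite orbT.
  by move=> /sE/sphi[y yx]; exists y; rewrite /psi yx.
split; last first.
  exists k, n, psi; split=> //; split=> // x y xy; apply: iphi.
  by rewrite phi_in (phi_in y); congr unitization_in.
split; first by exists (fun=> 0).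
split; first by move=> _ _ [x <-] [y <-]; exists (fun i => x i + y i).
split.
  move=> _ [x <-]; exists (fun i => -1 *: x i); rewrite psiZ.
  exact: (scaleN1r (psi x : nalg_module HR)).
split; first by move=> a _ [x <-]; exists (fun i => a *: x i).
by move=> _ _ [x <-] [y <-]; exists (fun i => x i *m y i).
Qed.

Lemma unitization_tsidealT (K : fieldType) (R : Type) (o : nalg_ops K R)
    (HR : is_nalg o) : two_sided_ideal (unitization_ideal HR (fun=> True)).
Proof.
split=> [|x y [x0 _] [y0 _]|a x [x0 _]|a x [x0 _]]; split=> //=.
- by rewrite x0 y0 subr0.
- by rewrite x0 mulr0.
- by rewrite x0 mul0r.
Qed.

Theorem theorem3p4 (K : fieldType) (R : Type) (oR : nalg_ops K R)
    (HR : is_nalg oR) (J : nideal oR) :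
  locally_matricial (ideal_ops J) ->
  locally_matricial (quot_ops J) ->
  locally_matricial oR.
Proof.
move=> lmJ lmQ; apply: (locally_mx_units_matricial (HR := HR)).
apply: (@locally_mx_units_extension _ _ (unitization_ideal HR J)).
- exact: unitization_tsideal.
- exact: unitization_tsidealT.
- by move=> x [].
- exact: unitization_locally_mat.
- exact: unitization_locally_mat_mod.
Qed.
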